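(* Let $V=\mathbb{R}^{d_1}$ and $W=\mathbb{R}^{d_2}$ be real vector spaces of respective dimensions $d_1$ and $d_2$. Let $\Omega_1 = V \cap \mathbb{Z}^{d_1}=\mathbb{Z}^{d_1}$ and $\Omega_2 = W \cap \mathbb{Z}^{d_2}=\mathbb{Z}^{d_2}$. Let $\rho: V \to W$ be a linear map such that $\rho(\Omega_1) \subseteq \Omega_2$. Let $U = \ker(\rho)$, and let $\Omega = U \cap \Omega_1$. Let $J$ be the rank of $\Omega$. Then for any subspace $U_0$ of $U$ which does not contain $\Omega$ there exists a point $\boldsymbol{x} \in \Omega \setminus U_0$ such that $$H(\boldsymbol{x}) \leq \left\{ 2 J^J \left( \frac{3}{2} \right)^{J-1} + J \right\} H(\Omega).$$
   Context: For $\boldsymbol{x}=(x_1,\dots,x_N)\in\mathbb{Z}^N$, the height is $H(\boldsymbol{x})=\max_{1\leq i\leq N}|x_i|$. For a lattice (subgroup) $\Lambda\subseteq\mathbb{Z}^N$ of rank $J\geq 1$, choose a $\mathbb{Z}$-basis $\boldsymbol{x}_1,\dots,\boldsymbol{x}_J$ and let $X=(\boldsymbol{x}_1\ \dots\ \boldsymbol{x}_J)$ be the $N\times J$ basis matrix. For each subset $I\subseteq\{1,\dots,N\}$ of cardinality $J$ let $X_I$ be the $J\times J$ submatrix formed by the rows of $X$ indexed by $I$. The height of the lattice is $H(\Lambda)=\max_{I}|\det(X_I)|$, which does not depend on the choice of basis. Here these are applied with $N=d_1$. (If some $U_0$ does not contain $\Omega$ then $\Omega\neq 0$, so $J\geq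 1$.) *)

(* Defs.v *)
From HB Require Import structures.
From mathcomp Require Import all_boot all_order all_algebra.
From mathcomp Require Import classical_sets reals.

Set Implicit Arguments.
Unset Strict Implicit.
Unset Printing Implicit Defensive.

Import Order.TTheory GRing.Theory Num.Theory.
Local Open Scope classical_set_scope.
Local Open Scope ring_scope.

Definition embZ (R : realType) (N : nat) (x : 'cV[int]_N) : 'cV[R]_N :=
  map_mx intr x.

Definition height (N : nat) (x : 'cV[int]_N) : nat :=
  (\max_(i < N) `|x i 0%R|)%N.

(* The columns of X form a Z-basis of L. *)
Definition is_lattice_basis (N J : nat) (L : set 'cV[int]_N)
    (X : 'M[int]_(N, J)) : Prop :=
  (forall x, L x <-> exists c : 'cV[int]_J, x = X *m c) /\
  (forall c : 'cV[int]_J, X *m c = 0 -> c = 0).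

Definition row_minor (N J : nat) (X : 'M[int]_(N, J))
    (I : {I : {set 'I_N} | #|I| == J}) : 'M[int]_J :=
  rowsub (fun j : 'I_J => enum_val (cast_ord (esym (eqP (valP I))) j)) X.

Definition basis_height (N J : nat) (X : 'M[int]_(N, J)) : nat :=
  (\max_(I : {I : {set 'I_N} | #|I| == J}) `|\det (row_minor X I)|)%N.

(* Every subgroup of Z^N has a basis, so the default value (the empty basis)
   is never used when L is a subgroup. *)
Definition lattice_basis (N : nat) (L : set 'cV[int]_N) :
    {J : nat & 'M[int]_(N, J)} :=
  xget (Tagged (fun J => 'M[int]_(N, J)) (0 : 'M[int]_(N, 0)))
    [set B | is_lattice_basis L (tagged B)].

Definition lattice_rank (N : nat) (L : set 'cV[int]_N) : nat :=
  tag (lattice_basis L).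

Definition lattice_height (N : nat) (L : set 'cV[int]_N) : nat :=
  basis_height (tagged (lattice_basis L)).

Lemma is_lattice_basis_factor (N J K : nat) (L : set 'cV[int]_N)
    (X : 'M[int]_(N, J)) (Y : 'M[int]_(N, K)) :
  is_lattice_basis L X -> is_lattice_basis L Y -> exists A, Y = X *m A.
Proof.
move=> [LX _] [LY _].
have cP (k : 'I_K) : exists c : 'cV[int]_J, col k Y == X *m c.
  have /LX[c cE] : L (col k Y) by apply/LY; exists (delta_mx k 0); rewrite colE.
  by exists c; apply/eqP.
exists (\matrix_(i, k) xchoose (cP k) i 0); apply/matrixP => i k.
have /eqP/matrixP/(_ i 0) := xchooseP (cP k); rewrite !mxE => ->.
by apply: eq_bigr => j _; rewrite !mxE.
Qed.

Lemma is_lattice_basis_inj (N J K : nat) (L : set 'cV[int]_N)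
    (X : 'M[int]_(N, J)) (A B : 'M[int]_(J, K)) :
  is_lattice_basis L X -> X *m A = X *m B -> A = B.
Proof.
move=> [_ X0] AB; apply/subr0_eq/matrixP => j k.
have /X0/matrixP/(_ j 0) : X *m col k (A - B) = 0.
  by rewrite colE mulmxA mulmxBr AB subrr mul0mx.
by rewrite !mxE.
Qed.

(* Rank and height do not depend on the basis chosen. *)
Lemma lattice_basis_indep (N J : nat) (L : set 'cV[int]_N)
    (X : 'M[int]_(N, J)) :
  is_lattice_basis L X ->
  lattice_rank L = J /\ lattice_height L = basis_height X.
Proof.
move=> LX; rewrite /lattice_rank /lattice_height.
have : is_lattice_basis L (tagged (lattice_basis L)).
  rewrite /lattice_basis; case: xgetP => [B _ //|noB].
  by case: (noB (Tagged (fun J => 'M[int]_(N, J)) X)).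
case: (lattice_basis L) => K Y /= LY.
have [A YE] := is_lattice_basis_factor LX LY.
have [B XE] := is_lattice_basis_factor LY LX.
have AB : A *m B = 1%:M.
  by apply: (is_lattice_basis_inj LX); rewrite mulmxA -YE -XE mulmx1.
have BA : B *m A = 1%:M.
  by apply: (is_lattice_basis_inj LY); rewrite mulmxA -XE -YE mulmx1.
have KJ : K = J by apply/eqP; rewrite eqn_leq (mulmx1_min AB) (mulmx1_min BA).
subst K; split=> //; apply: eq_bigr => I _.
have -> : row_minor Y I = row_minor X I *m A by rewrite /row_minor YE mul_rowsub_mx.
have dA : (`|\det A| * `|\det B| = 1)%N by rewrite -abszM -det_mulmx AB det1.
have /eqP dA1 : `|\det A|%N == 1%N by move/eqP: dA; rewrite muln_eq1 => /andP[].
by rewrite det_mulmx abszM dA1 muln1.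
Qed.

(* Omega: the integer points of the kernel of rho. *)
Definition ker_lattice (R : realType) (d1 d2 : nat)
    (rho : 'Hom('cV[R]_d1, 'cV[R]_d2)) : set 'cV[int]_d1 :=
  [set x | embZ R x \in lker rho].

(* Main.v *)
Require Import Defs.
From HB Require Import structures.
From mathcomp Require Import all_boot all_order all_algebra.
From mathcomp Require Import perm classical_sets reals.

(** Let the columns of [X] be a basis of Omega. If a maximal square submatrix
    [M] of [X] is nonsingular, then, by Cramer's rule, every entry of
    [X *m \adj M] is a maximal minor of [X] up to sign, so the columns of this
    matrix are points of Omega of height at most H(Omega). Since
    [X *m \adj M *m M = \det M *: X], these columns span Omega over the reals,
    so they cannot all lie in U0. This gives the bound with the constant 1. *)

Set Implicit Arguments.
Unset Strict Implicit.
Unset Printing Implicit Defensive.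

Import Order.TTheory GRing.Theory Num.Theory.
Local Open Scope ring_scope.

(** An injective [f] lists the rows of some [row_minor] in another order, which changes only the
    sign of the determinant; otherwise two rows coincide and the determinant vanishes. *)
Lemma abs_det_rowsub_le (N J : nat) (X : 'M[int]_(N, J)) (f : 'I_J -> 'I_N) :
  (`|\det (rowsub f X)| <= basis_height X)%N.
Proof.
have [/injectiveP f_inj | /injectivePn[i [j neq_ij fij]]] :=
  boolP (injectiveb f).
  have cardI : #|[set f k | k : 'I_J]| == J by rewrite card_imset // card_ord.
  set I : {I : {set 'I_N} | #|I| == J} :=
    exist (fun I : {set 'I_N} => #|I| == J) _ cardI.
  have fI k : f k \in val I by exact: imset_f.
  pose s k := cast_ord (eqP (valP I)) (enum_rank_in (fI k) (f k)).
  have sE k : enum_val (cast_ord (esym (eqP (valP I))) (s k)) = f k.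
    by rewrite /s cast_ordK enum_rankK_in.
  have s_inj : injective s by move=> k l skl; apply: f_inj; rewrite -!sE skl.
  have -> : rowsub f X = row_perm (perm s_inj) (row_minor X I).
    by apply/matrixP => k l; rewrite !mxE permE sE.
  rewrite row_permE det_mulmx det_perm abszMsign.
  exact: (leq_bigmax I (F := fun I => `|\det (row_minor X I)|%N)).
rewrite (determinant_alternate neq_ij) // => k.
by rewrite !mxE fij.
Qed.

(** Laplace expansion along row [j]: the cofactors of that row do not involve it, so they survive
    when row [f j] is replaced by row [i]. *)
Lemma mulmx_adj_rowsubE (R : comPzRingType) (N J : nat) (X : 'M[R]_(N, J))
    (f : 'I_J -> 'I_N) i j :
  (X *m \adj (rowsub f X)) i j =
  \det (rowsub (fun k => if k == j then i else f k) X).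
Proof.
rewrite (expand_det_row _ j) mxE; apply: eq_bigr => k _.
rewrite !mxE eqxx; congr (_ * (_ * \det _)).
by apply/matrixP => r c; rewrite !mxE eq_sym (negPf (neq_lift _ _)).
Qed.

Lemma height_mulmx_adj_le (N J : nat) (X : 'M[int]_(N, J))
    (f : 'I_J -> 'I_N) j :
  (height (col j (X *m \adj (rowsub f X))) <= basis_height X)%N.
Proof.
apply/bigmax_leqP => i _.
by rewrite mxE mulmx_adj_rowsubE abs_det_rowsub_le.
Qed.

(** A left inverse forces full column rank over the rationals, so some [J] rows are independent. *)
Lemma exists_nonzero_minor (N J : nat) (X : 'M[int]_(N, J))
    (Y : 'M[int]_(J, N)) :
  Y *m X = 1%:M -> exists f : 'I_J -> 'I_N, \det (rowsub f X) != 0.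
Proof.
move=> YX; pose XQ := map_mx (intr : int -> rat) X.
have fullX : row_full XQ.
  apply/row_fullP; exists (map_mx intr Y).
  by rewrite -map_mxM YX map_mx1.
exists (fullrankfun fullX).
have := fullrowsub_unit fullX.
rewrite -map_mxsub unitmxE unitfE det_map_mx.
by rewrite intr_eq0.
Qed.

(* The kernel is a direct summand of Z^n; [Y] is a projection onto it,
   expressed in the basis [X]. *)
Lemma int_kernel_basis (m n : nat) (A : 'M[int]_(m, n)) :
  exists J (X : 'M[int]_(n, J)) (Y : 'M[int]_(J, n)),
    [/\ Y *m X = 1%:M, A *m X = 0 &
        forall x : 'cV[int]_n, A *m x = 0 -> x = X *m (Y *m x)].
Proof.
have [L uL [R uR [d _ ->]]] := int_Smith_normal_form A.
set D := \matrix_(i, j) _.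
(* [S] indexes the zero columns of [D]: those past the last row, and those with zero diagonal entry,
   where [d] reads as 0 beyond its end. *)
pose S : {set 'I_n} := [set j : 'I_n | (m <= j)%N || (d`_j == 0)].
pose X0 : 'M[int]_(n, #|S|) := colsub enum_val 1%:M.
pose Y0 : 'M[int]_(#|S|, n) := rowsub enum_val 1%:M.
have YX0 : Y0 *m X0 = 1%:M.
  rewrite mul_rowsub_mx mul1mx; apply/matrixP => s t.
  by rewrite !mxE (inj_eq enum_val_inj).
have DX0 : D *m X0 = 0.
  rewrite mulmx_colsub mulmx1; apply/matrixP => i s; rewrite !mxE.
  case: eqP => // iE; have := enum_valP s; rewrite inE -iE.
  by rewrite leqNgt ltn_ord => /eqP ->.
have kerD (y : 'cV[int]_n) : D *m y = 0 -> y = X0 *m (Y0 *m y).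
  move=> Dy0; rewrite mul_rowsub_mx mul1mx; apply/matrixP => j k.
  rewrite mxE; have [jS | jNS] := boolP (j \in S).
    rewrite (bigD1 (enum_rank_in jS j)) //= !mxE enum_rankK_in // eqxx mul1r.
    rewrite big1 ?addr0 // => s sNj; rewrite !mxE.
    case: eqP => [jE|_]; last by rewrite mul0r.
    by case/eqP: sNj; apply: enum_val_inj; rewrite enum_rankK_in.
  rewrite big1 => [|s _]; last first.
    rewrite !mxE; case: eqP => [jE|_]; last by rewrite mul0r.
    by rewrite jE enum_valP in jNS.
  (* Outside [S], row [j] of [D *m y = 0] says that a nonzero multiple of [y j k] is 0. *)
  move: jNS; rewrite inE negb_or -ltnNge => /andP[jm dj].
  have /matrixP/(_ (Ordinal jm) k) := Dy0; rewrite !mxE (bigD1 j) //=.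
  rewrite mxE eqxx mulr1n big1 ?addr0 => [/eqP|l lNj].
    by rewrite mulf_eq0 (negPf dj) => /eqP.
  by rewrite mxE /= eq_sym val_eqE (negPf lNj) mul0r.
(* As [L] is invertible, [R] maps the kernel of [A] onto that of [D]. *)
exists #|S|, (invmx R *m X0), (Y0 *m R); split.
- by rewrite mulmxA mulmxK.
- by rewrite mulmxA mulmxK // -mulmxA DX0 mulmx0.
move=> x; rewrite -!mulmxA => Ax0.
have /kerD Rx : D *m (R *m x) = 0.
  by rewrite -[LHS](mulKmx uL) Ax0 mulmx0.
by rewrite -Rx mulKmx.
Qed.

(** By integrality, [rho] acts on integer points as an integer matrix, so Omega is an integer
    kernel. The left inverse [Y] is kept to obtain a nonzero minor. *)
Lemma ker_lattice_basis (R : realType) (d1 d2 : nat)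
    (rho : 'Hom('cV[R]_d1, 'cV[R]_d2)) :
  (forall x : 'cV[int]_d1,
     exists y : 'cV[int]_d2, rho (embZ R x) = embZ R y) ->
  exists J (X : 'M[int]_(d1, J)) (Y : 'M[int]_(J, d1)),
    Y *m X = 1%:M /\ is_lattice_basis (ker_lattice rho) X.
Proof.
move=> rho_int.
have ex_col k : exists y : 'cV[int]_d2, rho (embZ R (delta_mx k 0)) == embZ R y.
  by have [y /eqP] := rho_int (delta_mx k 0); exists y.
pose A : 'M[int]_(d2, d1) := \matrix_(i, k) xchoose (ex_col k) i 0.
have rhoE (x : 'cV[int]_d1) : rho (embZ R x) = embZ R (A *m x).
  have -> : embZ R x = \sum_k (x k 0)%:~R *: embZ R (delta_mx k 0).
    rewrite /embZ [in LHS](matrix_sum_delta x) raddf_sum; apply: eq_bigr => k _.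
    by rewrite big_ord1 /= map_mxZ.
  rewrite linear_sum /embZ; apply/matrixP => i j.
  rewrite summxE !mxE rmorph_sum; apply: eq_bigr => k _ /=.
  rewrite linearZ /= (eqP (xchooseP (ex_col k))) !mxE rmorphM mulrC.
  by rewrite ord1.
have kerE (x : 'cV[int]_d1) : ker_lattice rho x <-> A *m x = 0.
  rewrite /ker_lattice /= memv_ker rhoE.
  split=> [/eqP/matrixP Ax0 | ->]; last by rewrite /embZ map_mx0.
  apply/matrixP => i j; have /eqP := Ax0 i j.
  by rewrite [X in _ == X]mxE [X in X == _]mxE intr_eq0 => /eqP ->; rewrite mxE.
have [J [X [Y [YX AX kerX]]]] := int_kernel_basis A.
exists J, X, Y; split=> //; split=> [x | c Xc0].
  rewrite kerE; split=> [/kerX xE | [c ->]]; first by exists (Y *m x).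
  by rewrite mulmxA AX mul0mx.
by rewrite -[c]mul1mx -YX -mulmxA Xc0 mulmx0.
Qed.

Lemma embZ_mulmx_in (R : realType) (N J K : nat) (U : {vspace 'cV[R]_N})
    (X : 'M[int]_(N, J)) (C : 'M[int]_(J, K)) :
  (forall j, embZ R (col j X) \in U) -> forall k, embZ R (col k (X *m C)) \in U.
Proof.
move=> XU k.
have -> : embZ R (col k (X *m C)) = \sum_j (C j k)%:~R *: embZ R (col j X).
  apply/matrixP => i l; rewrite summxE !mxE rmorph_sum.
  by apply: eq_bigr => j _; rewrite !mxE rmorphM mulrC.
by apply: memv_suml => j _; apply/memvZ/XU.
Qed.

Theorem corollary5p2 (R : realType) (d1 d2 : nat)
    (rho : 'Hom('cV[R]_d1, 'cV[R]_d2))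
    (rho_int : forall x : 'cV[int]_d1,
       exists y : 'cV[int]_d2, rho (embZ R x) = embZ R y)
    (J : nat) (rankJ : J = lattice_rank (ker_lattice rho))
    (U0 : {vspace 'cV[R]_d1}) (U0_sub : (U0 <= lker rho)%VS)
    (U0_not : ~ (forall x : 'cV[int]_d1,
       ker_lattice rho x -> embZ R x \in U0)) :
  exists x : 'cV[int]_d1,
    [/\ ker_lattice rho x,
        embZ R x \notin U0 &
        (height x)%:R <=
          (2 * J%:R ^+ J * (3 / 2) ^+ (J - 1)%N + J%:R) *
          (lattice_height (ker_lattice rho))%:R :> R].
Proof.
have [K [X [Y [YX basisX]]]] := ker_lattice_basis rho_int.
have [rankE heightE] := lattice_basis_indep basisX.
rewrite heightE; move: rankJ; rewrite rankE => {rankE} JK; subst K.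
have [LX _] := basisX.
have [f detf] := exists_nonzero_minor YX.
set Z := X *m \adj (rowsub f X).
have [j ZjU0] : exists j, embZ R (col j Z) \notin U0.
  apply/existsP; rewrite -negb_forall; apply/negP => /forallP ZU0.
  apply: U0_not => x /LX[c ->].
  rewrite -[X *m c](col_id 0); apply: embZ_mulmx_in => {c} j.
  (* The columns of [Z *m rowsub f X] are those of [X] times a nonzero determinant, which can be
     divided out in the real subspace [U0]. *)
  have := embZ_mulmx_in (rowsub f X) ZU0 j.
  rewrite -mulmxA mul_adj_mx mul_mx_scalar linearZ /= /embZ map_mxZ rpredZeq.
  by rewrite intr_eq0 (negPf detf).
exists (col j Z); split=> //.
  by apply/LX; exists (col j (\adj (rowsub f X))); rewrite !colE mulmxA.
(* The index [j] witnesses that [J] is positive, so the summand [J] alone makes the stated factor at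
   least 1. *)
have J1 : 1 <= J%:R :> R by rewrite ler1n; apply: leq_ltn_trans (ltn_ord j).
apply: (@le_trans _ _ (basis_height X)%:R).
  by rewrite ler_nat height_mulmx_adj_le.
by rewrite ler_peMl // (le_trans J1) // lerDr !mulr_ge0 ?exprn_ge0 ?divr_ge0.
Qed.
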